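(* Let $s\ge 4$. There exist only finitely many (up to isomorphism) edge coalition graphs of the complete bipartite graph $K_{2,s}$, each of which is isomorphic to one of $K_{l,l'}$, $K_{l,l'}+e$ (with $2\le l,l'\le s$), or $K_4$.
   Context: Graphs are finite and simple. Two distinct edges are adjacent if they share an endpoint. A set $D\subseteq E$ is an edge-dominating set of $G=(V,E)$ if every edge in $E\setminus D$ is adjacent to an edge of $D$. Two disjoint sets of edges $E_1,E_2$ form an edge coalition if neither is an edge-dominating set but $E_1\cup E_2$ is. An $ec$-partition of $G$ is a partition $\pi=\{E_1,\ldots,E_k\}$ of $E$ into nonempty sets such that every $E_i$ is either a singleton edge-dominating set, or is not an edge-dominating set but forms an edge coalition with another set $E_j$ of $\pi$. For an $ec$-partition $\pi$ of $G$, the edge coalition graph $ECG(G,\pi)$ is the graph whose vertices are the sets of $\pi$, two vertices being adjacent if and only if the corresponding sets form an edge coalition in $G$. The edge coalition graphs of $G$ are the graphs $ECG(G,\pi)$ with $\pi$ an $ec$-partition of $G$. $K_{l,l'}+e$ denotes a graph obtained from the complete bipartite graph $K_{l,l'}$ by adding one edge $e$ joining two nonadjacent vertices. *)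

(* Defs.v *)
From HB Require Import structures.
From mathcomp Require Import all_boot.
Set Implicit Arguments.
Unset Strict Implicit.
Unset Printing Implicit Defensive.

Record sgraph : Type := SGraph {
  vertex :> finType;
  adj : rel vertex;
  adj_sym : symmetric adj;
  adj_irrefl : irreflexive adj }.

Definition isomorphic (G H : sgraph) : Prop :=
  exists2 f : G -> H, bijective f & forall x y, adj (f x) (f y) = adj x y.

Definition finitely_many_up_to_iso (P : sgraph -> Prop) : Prop :=
  exists (n : nat) (F : 'I_n -> sgraph),
    forall G, P G -> exists i, isomorphic G (F i).

Section EdgeCoalitions.
Variable G : sgraph.

Definition edges : {set {set G}} :=
  [set e | [exists x : G, exists y : G, adj x y && (e == [set x; y])]].

Definition edge_adjacent (e f : {set G}) : bool :=
  (e != f) && (e :&: f != set0).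

Definition edge_dominating (D : {set {set G}}) : bool :=
  (D \subset edges) &&
  [forall e in edges :\: D, exists f in D, edge_adjacent e f].

Definition edge_coalition (E1 E2 : {set {set G}}) : bool :=
  [&& E1 \subset edges, E2 \subset edges, [disjoint E1 & E2],
      ~~ edge_dominating E1, ~~ edge_dominating E2
    & edge_dominating (E1 :|: E2)].

(* [partition] already requires the blocks to be nonempty. *)
Definition ec_partition (pi : {set {set {set G}}}) : bool :=
  partition pi edges &&
  [forall X in pi,
     ((#|X| == 1) && edge_dominating X)
  || (~~ edge_dominating X
      && [exists Y in pi, (Y != X) && edge_coalition X Y])].

Lemma edge_coalition_sym : symmetric edge_coalition.
Proof.
move=> X Y; rewrite /edge_coalition disjoint_sym setUC.
case: (X \subset _); case: (Y \subset _); case: (edge_dominating X);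
  by case: (edge_dominating Y); rewrite //= ?andbF.
Qed.

Lemma edge_coalition_irrefl : irreflexive edge_coalition.
Proof.
by move=> X; rewrite /edge_coalition setUid; case: edge_dominating; rewrite ?andbF.
Qed.

Section ECG.
Variable pi : {set {set {set G}}}.

Definition ecg_rel : rel {X : {set {set G}} | X \in pi} :=
  fun X Y => edge_coalition (val X) (val Y).

Lemma ecg_sym : symmetric ecg_rel.
Proof. by move=> X Y; apply: edge_coalition_sym. Qed.

Lemma ecg_irrefl : irreflexive ecg_rel.
Proof. by move=> X; apply: edge_coalition_irrefl. Qed.

Definition ECG : sgraph := SGraph ecg_sym ecg_irrefl.
End ECG.

Definition edge_coalition_graph (H : sgraph) : Prop :=
  exists2 pi, ec_partition pi & H = ECG pi.

End EdgeCoalitions.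

Section CompleteBipartite.
Variables m n : nat.

Definition bip_rel : rel ('I_m + 'I_n) := fun u v =>
  match u, v with
  | inl _, inr _ | inr _, inl _ => true
  | _, _ => false
  end.

Lemma bip_sym : symmetric bip_rel. Proof. by case=> ? []. Qed.
Lemma bip_irrefl : irreflexive bip_rel. Proof. by case. Qed.

Definition complete_bipartite : sgraph := SGraph bip_sym bip_irrefl.
End CompleteBipartite.

Section Complete.
Variable n : nat.

Definition complete_rel : rel 'I_n := fun u v => u != v.

Lemma complete_sym : symmetric complete_rel.
Proof. by move=> u v; rewrite /complete_rel eq_sym. Qed.
Lemma complete_irrefl : irreflexive complete_rel.
Proof. by move=> u; rewrite /complete_rel eqxx. Qed.

Definition complete_graph : sgraph := SGraph complete_sym complete_irrefl.
End Complete.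

Section AddEdge.
Variables (G : sgraph) (x y : G).

(* [u != v] only matters when [x = y], and then no edge is added. *)
Definition add_edge_rel : rel G := fun u v =>
  adj u v || ((u != v) && ([set u; v] == [set x; y])).

Lemma add_edge_sym : symmetric add_edge_rel.
Proof. by move=> u v; rewrite /add_edge_rel adj_sym eq_sym setUC. Qed.
Lemma add_edge_irrefl : irreflexive add_edge_rel.
Proof. by move=> u; rewrite /add_edge_rel adj_irrefl eqxx. Qed.

Definition add_edge : sgraph := SGraph add_edge_sym add_edge_irrefl.
End AddEdge.

Definition is_plus_edge (G H : sgraph) : Prop :=
  exists x y : G, [/\ x != y, ~~ adj x y & isomorphic H (add_edge x y)].

(* Main.v *)
Require Import Defs.
From mathcomp Require Import all_boot.
Set Implicit Arguments.
Unset Strict Implicit.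
Unset Printing Implicit Defensive.

(** The edges of [K_{2,s}] fall into two stars, one at each of the two vertices
    of the part of size two, called hubs here.  Two edges are adjacent exactly
    when they lie in the same star or end at the same vertex of the part of
    size [s].  A set of edges that meets both stars is therefore
    edge-dominating, and so is a whole star; but a proper subset of a star is
    not, because if it misses an edge [e] of its star, then the edge of the
    other star with the same endpoint as [e] is not dominated
    ([edge_dominatingPn]).

    A single edge is a proper subset of its star, so an ec-partition has no
    dominating block: every block is a proper part of one star
    ([ec_block_proper]).  Hence an ec-partition cuts the two stars into [l] and
    [l'] blocks, with [2 <= l, l' <= s].  Two blocks in different stars always
    form a coalition, and two blocks in the same star do so exactly when their
    union is the star, which means that the star has only these two blocks
    ([ec_coalitionE]).  So the edge coalition graph is [K_{l,l'}] together with
    an edge inside each side that has exactly two vertices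
    ([two_sided_classification]): no side of size two gives [K_{l,l'}], one
    gives [K_{l,l'}+e], and two give [K_4].

    Finiteness is clear, since [K_{2,s}] has only finitely many edge
    partitions. *)

(** * Isomorphisms *)

Lemma isomorphic_refl (G : sgraph) : isomorphic G G.
Proof. by exists id => //; exists id. Qed.

Lemma isomorphic_sym (G H : sgraph) : isomorphic G H -> isomorphic H G.
Proof.
case=> f [g fK gK] fadj; exists g; first by exists f.
by move=> x y; rewrite -fadj !gK.
Qed.

Lemma isomorphic_complete (G : sgraph) n :
    #|G| = n -> (forall x y : G, adj x y = (x != y)) ->
  isomorphic G (complete_graph n).
Proof.
move=> cardG adjG; exists (fun x : G => cast_ord cardG (enum_rank x)).
  apply: inj_card_bij; last by rewrite card_ord cardG.
  by move=> x y /cast_ord_inj/enum_rank_inj.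
move=> x y; rewrite adjG /= /complete_rel.
by rewrite (inj_eq (@cast_ord_inj _ _ _)) (inj_eq enum_rank_inj).
Qed.

Lemma finitely_many_edge_coalition_graphs (G : sgraph) :
  finitely_many_up_to_iso (edge_coalition_graph G).
Proof.
exists #|{: {set {set {set G}}}}|, (fun i => ECG (enum_val i)) => H [pi _ ->].
by exists (enum_rank pi); rewrite enum_rankK; apply: isomorphic_refl.
Qed.

(** * Complete bipartite graphs whose sides of size two are filled in *)

Lemma eq_set2_card2 (T : finType) (A : {set T}) (u v : T) :
  #|A| = 2 -> u != v -> ([set u; v] == A) = (u \in A) && (v \in A).
Proof.
move=> cardA uv; apply/eqP/andP => [<-|[uA vA]]; first by rewrite set21 set22.
by apply/eqP; rewrite eqEcard cardA cards2 uv subUset !sub1set uA vA.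
Qed.

Section TwoSided.
Variables (H : sgraph) (side : H -> bool).
Let size_of b := #|[pred x | side x == b]|.
Let K := complete_bipartite (size_of true) (size_of false).
Hypothesis adjE : forall x y,
  adj x y = (side x != side y) || (x != y) && (size_of (side x) == 2).

Let left_of (u : K) : bool := if u is inl _ then true else false.

Lemma bip_left (u v : K) : adj u v = (left_of u != left_of v).
Proof. by case: u; case: v. Qed.

Lemma card_left_of b : #|[set u | left_of u == b]| = size_of b.
Proof.
rewrite cardsE -sum1_card big_sumType /=.
by case: b; rewrite ?big_pred0_eq ?sum1_card ?card_ord ?addn0.
Qed.

(** The parametrisation goes from [K] to [H], because enumerating the elements
    of a side needs no default vertex. *)
Lemma two_sided_parametrisation :
  exists2 g : K -> H, bijective g & forall u, side (g u) = left_of u.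
Proof.
pose g (u : K) : H :=
  match u with inl i => enum_val i | inr j => enum_val j end.
have side_g u : side (g u) = left_of u.
  by case: u => i; apply/eqP; apply: (enum_valP i).
exists g => //; apply: inj_card_bij => [u v guv|].
  have := congr1 side guv; rewrite !side_g.
  by case: u v guv => [i|i] [j|j] //= /enum_val_inj ->.
rewrite card_sum !card_ord /size_of -(cardC [pred x | side x == true]).
rewrite leq_add2l subset_leq_card //.
by apply/subsetP => x; rewrite !inE; case: side.
Qed.

Lemma two_sided_complete :
  size_of true = 2 -> size_of false = 2 -> isomorphic H (complete_graph 4).
Proof.
move=> nt nf; apply: isomorphic_complete => [|x y].
  have [g /bij_eq_card <- _] := two_sided_parametrisation.
  by rewrite card_sum !card_ord nt nf.
rewrite adjE; have -> : size_of (side x) = 2 by case: (side x).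
by rewrite andbT; have [->|] := eqVneq x y; rewrite ?eqxx ?orbT.
Qed.

Lemma two_sided_bipartite :
  (forall b, size_of b != 2) -> isomorphic H K.
Proof.
move=> n2; apply: isomorphic_sym.
have [g bij_g side_g] := two_sided_parametrisation.
exists g => // u v.
by rewrite adjE !side_g (negPf (n2 _)) andbF orbF bip_left.
Qed.

Lemma two_sided_plus_edge b :
  size_of b = 2 -> size_of (~~ b) != 2 -> is_plus_edge K H.
Proof.
move=> nb nNb; have [g bij_g side_g] := two_sided_parametrisation.
have card_b := card_left_of b; rewrite nb in card_b.
have /cards2P[x [y [xy bE]]] : #|[set u | left_of u == b]| == 2 by apply/eqP.
have /eqP xb : left_of x == b by have := set21 x y; rewrite -bE inE.
have /eqP yb : left_of y == b by have := set22 x y; rewrite -bE inE.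
exists x, y; split; rewrite ?bip_left ?xb ?yb ?eqxx //.
apply: isomorphic_sym; exists g => // u v.
rewrite adjE !side_g (inj_eq (bij_inj bij_g)) /= /add_edge_rel bip_left.
case: (eqVneq u v) => [->|uv] //=.
rewrite -bE (eq_set2_card2 card_b uv) !inE.
case: (eqVneq (left_of u) (left_of v)) => //= <-; rewrite andbb.
have [->|] := eqVneq (left_of u) b; first by rewrite nb.
move=> ub; have -> : left_of u = ~~ b.
  by move: ub; case: (left_of u) (b) => [] [].
exact: negbTE.
Qed.

Lemma two_sided_classification s :
  (forall b, 2 <= size_of b <= s) ->
  [\/ exists l l' : nat,
        [/\ 2 <= l <= s, 2 <= l' <= s & isomorphic H (complete_bipartite l l')],
      exists l l' : nat,
        [/\ 2 <= l <= s, 2 <= l' <= s & is_plus_edge (complete_bipartite l l') H]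
    | isomorphic H (complete_graph 4)].
Proof.
move=> bnd.
have [nt|nt] := eqVneq (size_of true) 2; have [nf|nf] := eqVneq (size_of false) 2.
- by apply: Or33; apply: two_sided_complete.
- apply: Or32; exists (size_of true), (size_of false); split=> //.
  exact: (two_sided_plus_edge (b := true)).
- apply: Or32; exists (size_of true), (size_of false); split=> //.
  exact: (two_sided_plus_edge (b := false)).
- apply: Or31; exists (size_of true), (size_of false); split=> //.
  by apply: two_sided_bipartite => -[].
Qed.
End TwoSided.

(** * Edge domination in the complete bipartite graph with two hubs *)

Section TwoHubs.
Variable s : nat.
Local Notation K2s := (complete_bipartite 2 s).

(** The hubs are indexed by booleans, so that the other hub is a negation. *)
Definition hub (b : bool) : 'I_2 := if b then ord0 else ord_max.

Definition link (b : bool) (j : 'I_s) : {set K2s} := [set inl (hub b); inr j].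

Definition star (b : bool) : {set {set K2s}} := [set link b j | j : 'I_s].

Lemma hub_inj : injective hub. Proof. by do 2!case. Qed.

Lemma hub_surj (i : 'I_2) : exists b, i = hub b.
Proof.
by case: i => [[|[|//]] ?]; [exists true | exists false]; apply: val_inj.
Qed.

Lemma inl_link a b j : (inl (hub a) \in link b j) = (a == b).
Proof.
by rewrite !inE orbF; apply/eqP/eqP => [[/hub_inj]|->].
Qed.

Lemma inr_link b j k : (inr k \in link b j) = (k == j).
Proof. by rewrite !inE; apply/eqP/eqP => [[]|->]. Qed.

Lemma link_eq a b j k : (link a j == link b k) = (a == b) && (j == k).
Proof.
apply/eqP/andP => [E|[/eqP-> /eqP->] //].
by rewrite -(inl_link a b k) -(inr_link b k j) -E inl_link inr_link !eqxx.
Qed.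

Lemma link_inj b : injective (link b).
Proof. by move=> j k /eqP; rewrite link_eq eqxx => /eqP. Qed.

Lemma link_meet a b j k :
  (link a j :&: link b k != set0) = (a == b) || (j == k).
Proof.
apply/set0Pn/orP => [[[i|i]]|].
- have [c ->] := hub_surj i; rewrite inE !inl_link => /andP[/eqP<- ?].
  by left.
- by rewrite inE !inr_link => /andP[/eqP<- ?]; right.
- case=> /eqP <-; [exists (inl (hub a)) | exists (inr j)].
    by rewrite inE !inl_link eqxx.
  by rewrite inE !inr_link eqxx.
Qed.

Lemma link_edge b j : link b j \in edges K2s.
Proof.
rewrite inE; apply/existsP; exists (inl (hub b)).
by apply/existsP; exists (inr j); rewrite /= eqxx.
Qed.

Lemma edgeP (e : {set K2s}) : e \in edges K2s -> exists b j, e = link b j.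
Proof.
rewrite inE => /existsP[[i|i]] /existsP[[j|j]] //= /eqP->.
  by have [b ->] := hub_surj i; exists b, j.
by have [b ->] := hub_surj j; exists b, i; rewrite setUC.
Qed.

Lemma link_star a b j : (link a j \in star b) = (a == b).
Proof.
apply/imsetP/eqP => [[k _ /eqP]|->]; last by exists j.
by rewrite link_eq => /andP[/eqP].
Qed.

Lemma card_star b : #|star b| = s.
Proof. by rewrite card_imset ?card_ord //; apply: link_inj. Qed.

(** An edge of [D] meets itself, so the condition on the edges outside [D] may
    be imposed on all edges. *)
Lemma edge_dominatingP (D : {set {set K2s}}) : D \subset edges K2s ->
  reflect (forall b j, exists a k, link a k \in D /\ (a == b) || (j == k))
          (edge_dominating D).
Proof.
move=> subD; rewrite /edge_dominating subD /=.
apply: (iffP forall_inP) => domD.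
  move=> b j; have [bjD|bjD] := boolP (link b j \in D).
    by exists b, j; rewrite !eqxx.
  have /domD/exists_inP[f fD] : link b j \in edges K2s :\: D.
    by rewrite inE bjD link_edge.
  have [a [k fE]] := edgeP (subsetP subD _ fD).
  rewrite fE /edge_adjacent link_meet => /andP[_ adj_bk].
  by exists a, k; rewrite -fE eq_sym.
move=> e /setDP[/edgeP[b [j ->]] bjD].
have [a [k [akD adj_ak]]] := domD b j.
apply/exists_inP; exists (link a k) => //.
rewrite /edge_adjacent link_meet [b == a]eq_sym adj_ak andbT.
by apply: contraNneq bjD => ->.
Qed.

(** If [D] meets both stars, then every edge has an edge of [D] in its own star.
    If it misses one, then it lies in the other one and fails to dominate
    unless it is all of it. *)
Lemma edge_dominatingPn (D : {set {set K2s}}) :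
    D \subset edges K2s ->
  reflect (exists b, D \proper star b) (~~ edge_dominating D).
Proof.
move=> subD; apply: (iffP idP); last first.
  (* the edge of the other star with the endpoint of the missing edge *)
  case=> b /properP[subb [_ /imsetP[j _ ->] bjD]].
  apply/edge_dominatingP => // /(_ (~~ b) j)[a [k [akD]]].
  have /eqP ab : a == b by rewrite -(link_star a b k) (subsetP subb).
  rewrite ab in akD *.
  by case/orP=> /eqP; [case: (b) | move=> jk; rewrite jk akD in bjD].
move=> ndomD.
have /existsP[c /pred0P missc] : [exists c, [disjoint D & star c]].
  apply: contraR ndomD; rewrite negb_exists => /forallP meetD.
  apply/edge_dominatingP => // b j.
  have /pred0Pn[e /andP[/= eD /imsetP[k _ eE]]] := meetD b.
  by exists b, k; rewrite -eE eD eqxx.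
have subc : D \subset star (~~ c).
  apply/subsetP => e eD; have [a [k eE]] := edgeP (subsetP subD _ eD).
  have := missc e; rewrite /= eD eE !link_star /=.
  by case: (a) (c) => [] [].
exists (~~ c); rewrite properEneq subc andbT.
apply: contraNneq ndomD => DE; apply/edge_dominatingP => // b j.
by exists (~~ c), j; rewrite DE link_star !eqxx orbT.
Qed.

(** * The blocks of an edge coalition partition *)

Variable pi : {set {set {set K2s}}}.
Hypotheses (s_gt1 : 1 < s) (ec_pi : ec_partition pi).

Let part_pi : partition pi (edges K2s). Proof. by case/andP: ec_pi. Qed.

Let block_neq0 X : X \in pi -> X != set0.
Proof.
by case/and3P: part_pi => _ _ pi0 Xpi; apply: contraNneq pi0 => <-.
Qed.

Let block_sub X : X \in pi -> X \subset edges K2s.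
Proof.
by move=> Xpi; rewrite -(cover_partition part_pi) (bigcup_max X).
Qed.

Let block_disjoint X Y : X \in pi -> Y \in pi -> X != Y -> [disjoint X & Y].
Proof. by case/and3P: part_pi => _ /trivIsetP tI _; apply: tI. Qed.

(** A dominating block of an ec-partition is a singleton, and a singleton is
    proper in its star, which has at least two edges. *)
Lemma ec_block_proper X : X \in pi -> exists b, X \proper star b.
Proof.
move=> Xpi; have subX := block_sub Xpi.
case/andP: ec_pi => _ /forall_inP/(_ X Xpi)/orP[/andP[/cards1P[e XE] _]|].
  have [b [j eE]] : exists b j, e = link b j.
    by apply/edgeP/(subsetP subX); rewrite XE set11.
  exists b; rewrite properEcard card_star XE cards1 s_gt1 andbT.
  by rewrite sub1set eE link_star.
by case/andP=> ndomX _; apply/edge_dominatingPn.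
Qed.

Definition block_side (X : {set {set K2s}}) : bool := X \subset star true.

Lemma block_side_proper X : X \in pi -> X \proper star (block_side X).
Proof.
move=> Xpi; have [[] Xb] := ec_block_proper Xpi; rewrite /block_side.
  by rewrite (proper_sub Xb).
have /set0Pn[e eX] := block_neq0 Xpi.
have /imsetP[j _ eE] := subsetP (proper_sub Xb) e eX.
suff /negbTE -> : ~~ (X \subset star true) by [].
by apply/subsetPn; exists e => //; rewrite eE link_star.
Qed.

Lemma link_block_side X b j : X \in pi -> link b j \in X -> block_side X = b.
Proof.
move=> Xpi bjX; have := subsetP (proper_sub (block_side_proper Xpi)) _ bjX.
by rewrite link_star eq_sym => /eqP.
Qed.

Definition blocks_on (b : bool) := [set X in pi | block_side X == b].

Lemma partition_blocks_on b : partition (blocks_on b) (star b).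
Proof.
have subP : blocks_on b \subset pi by apply/subsetP => X; rewrite inE => /andP[].
case/and3P: part_pi => /eqP covE tI pi0; apply/and3P; split.
- rewrite eqEsubset; apply/andP; split.
    apply/bigcupsP => X; rewrite inE => /andP[Xpi /eqP <-].
    exact: proper_sub (block_side_proper Xpi).
  apply/subsetP => e /imsetP[j _ ->].
  have: link b j \in cover pi by rewrite covE link_edge.
  case/bigcupP=> X Xpi bjX; apply/bigcupP; exists X => //.
  by rewrite inE Xpi (link_block_side Xpi bjX) eqxx.
- exact: trivIsetS subP tI.
- by apply: contra pi0; apply: (subsetP subP).
Qed.

Lemma card_blocks_on b : 2 <= #|blocks_on b| <= s.
Proof.
have partb := partition_blocks_on b; apply/andP; split.
  (* a block through the first edge is proper, and misses another block *)
  have: link b (Ordinal (ltnW s_gt1)) \in cover (blocks_on b).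
    by rewrite (cover_partition partb) link_star.
  case/bigcupP=> X Xb _; move: (Xb); rewrite inE => /andP[Xpi /eqP sX].
  have := block_side_proper Xpi; rewrite sX => /properP[_ [e]].
  rewrite -(cover_partition partb) => /bigcupP[Y Yb eY] eX.
  apply/card_gt1P; exists X, Y; split=> //.
  by apply: contraNneq eX => ->.
apply: (leq_trans _ (eq_leq (card_star b))).
rewrite (card_partition partb) -sum1_card leq_sum // => X.
by rewrite inE => /andP[/block_neq0]; rewrite card_gt0.
Qed.

(** A third block on the same side would have its edges outside [X :|: Y]. *)
Lemma union_star X Y : X \in pi -> Y \in pi -> X != Y ->
    block_side X = block_side Y ->
  (X :|: Y == star (block_side X)) = (#|blocks_on (block_side X)| == 2).
Proof.
move=> Xpi Ypi XY sXY; set b := block_side X.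
have Xb : X \in blocks_on b by rewrite inE Xpi eqxx.
have Yb : Y \in blocks_on b by rewrite inE Ypi -sXY eqxx.
have covb := cover_partition (partition_blocks_on b).
apply/eqP/idP => [XYE|cardb]; last first.
  have /eqP bE : [set X; Y] == blocks_on b.
    by rewrite (eq_set2_card2 (eqP cardb) XY) Xb.
  by rewrite -covb -bE /cover bigcup_setU !big_set1.
suff <- : [set X; Y] = blocks_on b by rewrite cards2 XY.
apply/eqP; rewrite eqEsubset subUset !sub1set Xb Yb /=.
apply/subsetP => Z; rewrite inE => /andP[Zpi /eqP sZ].
have /set0Pn[e eZ] := block_neq0 Zpi.
have := subsetP (proper_sub (block_side_proper Zpi)) e eZ.
rewrite sZ -XYE; apply: contraTT.
rewrite !inE !negb_or => /andP[ZX ZY].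
by rewrite !(disjointFr (block_disjoint Zpi _ _) eZ).
Qed.

Lemma ec_coalitionE X Y : X \in pi -> Y \in pi ->
  edge_coalition X Y =
    (block_side X != block_side Y)
    || (X != Y) && (#|blocks_on (block_side X)| == 2).
Proof.
move=> Xpi Ypi; have [->|XY] /= := eqVneq X Y.
  by rewrite edge_coalition_irrefl eqxx.
have ndom Z : Z \in pi -> ~~ edge_dominating Z.
  move=> Zpi; apply/edge_dominatingPn; first exact: block_sub.
  exact: ec_block_proper.
rewrite /edge_coalition !block_sub ?block_disjoint ?ndom //=.
have subXY : X :|: Y \subset edges K2s by rewrite subUset !block_sub.
have sX := proper_sub (block_side_proper Xpi).
have sY := proper_sub (block_side_proper Ypi).
have [sXY|sXY] /= := eqVneq (block_side X) (block_side Y).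
  have subb : X :|: Y \subset star (block_side X) by rewrite subUset sX sXY sY.
  rewrite -(union_star Xpi Ypi XY sXY); apply/idP/eqP => [domXY|XYE].
    apply/eqP; apply: contraTT domXY => XYN; apply/edge_dominatingPn => //.
    by exists (block_side X); rewrite properEneq XYN.
  apply: contraT => /(edge_dominatingPn subXY)[b]; rewrite XYE.
  by move/proper_card; rewrite !card_star ltnn.
apply: contraT => /(edge_dominatingPn subXY)[b /proper_sub].
rewrite subUset => /andP[Xb Yb]; case/negP: sXY; apply/eqP.
have side_b Z : Z \in pi -> Z \subset star b -> block_side Z = b.
  move=> Zpi Zb; have /set0Pn[e eZ] := block_neq0 Zpi.
  have /imsetP[j _ eE] := subsetP Zb e eZ.
  by rewrite (link_block_side (b := b) (j := j)) -?eE.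
by rewrite !side_b.
Qed.

Lemma card_side_ECG b :
  #|[pred x : ECG pi | block_side (val x) == b]| = #|blocks_on b|.
Proof.
rewrite -(card_image val_inj); apply: eq_card => X.
rewrite inE; apply/imageP/andP => [[x xb ->]|[Xpi Xb]].
  by split; [apply: valP | ].
by exists (Sub X Xpi).
Qed.

End TwoHubs.

Theorem theorem7p1 (s : nat) (hs : 4 <= s) :
  finitely_many_up_to_iso (edge_coalition_graph (complete_bipartite 2 s)) /\
  (forall H : sgraph, edge_coalition_graph (complete_bipartite 2 s) H ->
     [\/ exists l l' : nat,
           [/\ 2 <= l <= s, 2 <= l' <= s
             & isomorphic H (complete_bipartite l l')],
         exists l l' : nat,
           [/\ 2 <= l <= s, 2 <= l' <= s
             & is_plus_edge (complete_bipartite l l') H]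
       | isomorphic H (complete_graph 4)]).
Proof.
split; first exact: finitely_many_edge_coalition_graphs.
move=> H [pi ec_pi ->]; have s_gt1 : 1 < s by apply: leq_trans hs.
pose side (x : ECG pi) := block_side (val x).
apply: (two_sided_classification (side := side)) => [x y|b].
  by rewrite card_side_ECG [LHS](ec_coalitionE s_gt1 ec_pi) ?(valP x) ?(valP y).
by rewrite card_side_ECG card_blocks_on.
Qed.
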